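(* Let $G$ be a connected $\alpha$-regular graph where $\alpha$ is an infinite cardinal. Then $D'(G) \le 2$.
   Context: Graphs are undirected, without loops or multiple edges, possibly infinite. A graph is $\alpha$-regular if every vertex has exactly $\alpha$ neighbors. An edge coloring of $G$ is any function from $E(G)$ to a set of colors (not required to be proper). An automorphism of $G$ preserves an edge coloring if it maps every edge to an edge of the same color. The distinguishing index $D'(G)$ is the least cardinal $d$ such that $G$ has an edge coloring with $d$ colors preserved only by the identity automorphism. *)

(* Defs.v *)
From Stdlib Require Export Relation_Operators.
From mathcomp Require Export all_boot.
From mathcomp Require Export boolp classical_sets functions cardinality.

Set Implicit Arguments.
Unset Strict Implicit.
Unset Printing Implicit Defensive.

Local Open Scope classical_set_scope.
Local Open Scope card_scope.

(* Cardinals are represented by types, compared through their full sets with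
   [#<=] (existence of an injection) and [#=] (existence of a bijection). *)

Record graph := Graph {
  vertex :> Type;
  adj : vertex -> vertex -> Prop;
  adj_sym : forall x y, adj x y -> adj y x;
  adj_irrefl : forall x, ~ adj x x
}.

Definition connected_graph (G : graph) : Prop :=
  forall x y : G, clos_refl_trans G (@adj G) x y.

Definition regular (A : Type) (G : graph) : Prop :=
  forall x : G, [set y | adj x y] #= [set: A].

Definition edge_set (G : graph) : set (set G) :=
  [set e | exists x y : G, adj x y /\ e = [set x; y]].

Definition edge (G : graph) : Type := {e : set G | edge_set e}.

Definition automorphism (G : graph) (f : G -> G) : Prop :=
  bijective f /\ forall x y : G, adj x y <-> adj (f x) (f y).

Definition preserves (G : graph) (C : Type) (f : G -> G) (c : edge G -> C)
  : Prop :=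
  forall e e' : edge G, sval e' = f @` sval e -> c e' = c e.

Definition distinguishing (G : graph) (C : Type) (c : edge G -> C) : Prop :=
  forall f : G -> G, automorphism f -> preserves f c -> forall x : G, f x = x.

(* The cardinal of [D] is the distinguishing index D'(G). This is a relation
   rather than a function because D'(G) is undefined for some graphs (such as
   the graph with two vertices joined by an edge). *)
Definition distinguishing_index (G : graph) (D : Type) : Prop :=
  (exists c : edge G -> D, distinguishing c) /\
  (forall C : Type, (exists c : edge G -> C, distinguishing c) ->
     [set: D] #<= [set: C]).

(* Main.v *)
Require Import Defs.
From mathcomp Require wochoice.
From Stdlib Require Import Wf_nat Inverse_Image.
Local Open Scope classical_set_scope.
Local Open Scope card_scope.

Set Implicit Arguments.
Unset Strict Implicit.
Unset Printing Implicit Defensive.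

(* A colouring with two colours amounts to a red subgraph, here a spanning
   forest whose nodes carry well-ordered labels: a node labelled [l] has exactly
   one child labelled [j] for each [j < l], and the roots have distinct labels,
   none of which is a successor. To find it, observe that [G] has as many
   vertices as each vertex has neighbours, so a transfinite greedy choice gives
   an injection [g] on pairs such that [g v j] is a neighbour of [v] occurring
   after [v] in a well-order of the vertices; labels are then assigned by
   recursion along this order, [g v j] being a child of [v] if [j] is smaller
   than the label of [v] and a root otherwise. Transfinite pruning of the nodes
   with exactly one remaining neighbour recovers the labels of all nodes other
   than roots, so the forest has no nontrivial automorphism. *)

(** * Embeddings of types and finiteness *)

Definition embeds (X Y : Type) : Prop := exists f : X -> Y, injective f.

Lemma embeds_trans X Y Z : embeds X Y -> embeds Y Z -> embeds X Z.
Proof. by move=> [f fI] [g gI]; exists (g \o f); apply: inj_comp. Qed.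

Lemma embeds_prod X X' Y Y' :
  embeds X Y -> embeds X' Y' -> embeds (X * X') (Y * Y').
Proof.
move=> [f fI] [g gI]; exists (fun p => (f p.1, g p.2)).
by move=> [a b] [c d] /= [/fI -> /gI ->].
Qed.

Lemma sval_inj_prop T (P : T -> Prop) : injective (@sval T P).
Proof. by move=> [x px] [y py] /= ?; subst y; congr exist. Qed.

Lemma embeds_sig T (P Q : T -> Prop) :
  (forall x, P x -> Q x) -> embeds {x | P x} {x | Q x}.
Proof.
move=> PQ; exists (fun x : {x | P x} => exist Q (sval x) (PQ _ (svalP x))).
by move=> x y [/sval_inj_prop].
Qed.

Lemma embeds_card_le X Y : embeds X Y <-> [set: X] #<= [set: Y].
Proof.
split=> [[f fI]|/card_leP[f]].
  apply/card_leP/injfunPex.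
  exists (fun x : [set: X] =>
            SigSub (mem_set (I : [set: Y] (f (\val x))))) => //.
  by move=> x y _ _ /(congr1 val) /= /fI /val_inj.
exists (fun x => \val (f (SigSub (mem_set (I : [set: X] x))))).
by move=> x y /val_inj /(inj (in_setT _) (in_setT _)) /(congr1 val).
Qed.

Lemma embeds_natP X : embeds nat X <-> infinite_set [set: X].
Proof. by rewrite embeds_card_le infiniteP. Qed.

Lemma finite_option X : finite_set [set: X] -> finite_set [set: option X].
Proof.
move=> fX; have -> : [set: option X] = [set None] `|` Some @` [set: X].
  by apply/seteqP; split=> // -[x|] _; [right; exists x|left].
by rewrite finite_setU; split; [exact: finite_set1|exact: finite_image].
Qed.

Lemma finite_prod X Y :
  finite_set [set: X] -> finite_set [set: Y] -> finite_set [set: X * Y].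
Proof. by rewrite -setXTT; exact: finite_setX. Qed.

(** Hilbert's hotel: [None] goes to the start of a copy of [nat] in [X], whose elements move up by
    one. *)
Lemma embeds_option X : embeds nat X -> embeds (option X) X.
Proof.
move=> [h hI].
pose f (o : option X) := if o is Some x then
  if pselect (exists n, h n = x) is left e then h (sval (cid e)).+1 else x
  else h 0.
have fS n : f (Some (h n)) = h n.+1.
  rewrite /f; case: pselect => [e|[]]; last by exists n.
  by rewrite (hI _ _ (svalP (cid e))).
have fN x : ~ (exists n, h n = x) -> f (Some x) = x.
  by rewrite /f; case: pselect.
exists f; case=> [x|] [y|] //.
- case: (pselect (exists n, h n = x)) => [[n <-]|nx];
  case: (pselect (exists n, h n = y)) => [[m <-]|ny].
  + by rewrite !fS => /hI [->].
  + by rewrite fS fN // => e; case: ny; exists n.+1.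
  + by rewrite fS fN // => e; case: nx; exists m.+1.
  + by rewrite !fN // => ->.
- case: (pselect (exists n, h n = x)) => [[n <-]|nx]; first by rewrite fS => /hI.
  by rewrite fN // => e; case: nx; exists 0.
- case: (pselect (exists n, h n = y)) => [[n <-]|nx]; first by rewrite fS => /hI.
  by rewrite fN // => e; case: nx; exists 0.
Qed.

(** * Well-orders, recursion and greedy choice *)

Definition well_ordered T (lt : T -> T -> Prop) : Prop :=
  [/\ well_founded lt, (forall x y z, lt x y -> lt y z -> lt x z)
    & forall x y, [\/ lt x y, x = y | lt y x]].

Lemma wf_irrefl T (lt : T -> T -> Prop) x : well_founded lt -> ~ lt x x.
Proof. by move=> wf; elim/(well_founded_ind wf): x => x IH xx; apply: (IH x). Qed.

Lemma wf_asym T (lt : T -> T -> Prop) x y :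
  well_founded lt -> lt x y -> ~ lt y x.
Proof.
move=> wf; elim/(well_founded_ind wf): x y => x IH y xy yx.
exact: (IH y yx x).
Qed.

Lemma well_ordered_exists T : exists lt : T -> T -> Prop, well_ordered lt.
Proof.
have [R Rwo] := wochoice.well_ordering_principle {classic T}.
have RC : wochoice.wo_chain R predT by move=> A _; apply: Rwo.
have tot x y : R x y \/ R y x.
  by apply/orP; apply: (wochoice.wo_chainW RC).
have anti x y : R x y -> R y x -> x = y.
  move=> xy yx; apply: (wochoice.wo_chain_antisymmetric RC) => //.
  by rewrite xy yx.
have Rmin (P : T -> Prop) : (exists x, P x) ->
    exists x, P x /\ forall y, P y -> R x y.
  move=> [x Px]; have [|z [[zP zmin] _]] := Rwo [pred x | `[< P x >]].
    by exists x; apply/asboolP.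
  exists z; split; first by apply/asboolP.
  by move=> y Py; apply: zmin; apply/asboolP.
exists (fun x y => ~ R y x); split.
- move=> x; apply: contrapT => nx.
  have [z [nz zmin]] := Rmin _ (ex_intro (fun x => ~ Acc _ x) x nx).
  apply: nz; constructor => y Ryz; apply: contrapT => /zmin.
  exact: Ryz.
- move=> x y z nyx nzy zx.
  (* Transitivity comes from the [R]-least of [x], [y], [z]: each candidate is contradictory. *)
  have [w [Pw wmin]] := Rmin [set u | u = x \/ u = y \/ u = z]
    (ex_intro _ x (or_introl erefl)).
  case: Pw => [e|[e|e]]; subst w.
  + have xz : R x z by apply: wmin; right; right.
    have e := anti _ _ xz zx; subst z.
    by apply: nzy; apply: wmin; right; left.
  + by apply: nyx; apply: wmin; left.
  + by apply: nzy; apply: wmin; right; left.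
- move=> x y; case: (pselect (R x y)) => xy; last by constructor 3.
  case: (pselect (R y x)) => yx; last by constructor 1.
  by constructor 2; apply: anti.
Qed.

Lemma well_ordered_preim X T (f : X -> T) (lt : T -> T -> Prop) :
  injective f -> well_ordered lt -> well_ordered (fun x y => lt (f x) (f y)).
Proof.
move=> fI [wf tr tot]; split; first exact: wf_inverse_image.
- by move=> x y z; apply: tr.
- move=> x y; case: (tot (f x) (f y)) => [|/fI|];
    by [constructor 1|constructor 2|constructor 3].
Qed.

Definition lex X Y (lX : X -> X -> Prop) (lY : Y -> Y -> Prop) (p q : X * Y) :=
  lX p.1 q.1 \/ p.1 = q.1 /\ lY p.2 q.2.

Lemma well_ordered_lex X Y (lX : X -> X -> Prop) (lY : Y -> Y -> Prop) :
  well_ordered lX -> well_ordered lY -> well_ordered (lex lX lY).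
Proof.
move=> [wX trX totX] [wY trY totY]; split.
- move=> [x y]; elim/(well_founded_ind wX): x y => x IHx.
  elim/(well_founded_ind wY) => y IHy.
  by constructor=> -[x' y'] [/=|/= [-> ]]; [move/IHx|move/IHy].
- move=> [a b] [c d] [e f] [/= ac|/= [-> bd]] [/= ce|/= [<- df]].
  + by left; apply: trX ce.
  + by left.
  + by left.
  + by right; split=> //; apply: trY df.
- move=> [a b] [c d]; case: (totX a c) => [ac|<-|ca].
  + by constructor 1; left.
  + case: (totY b d) => [bd|<-|db];
      by [constructor 1; right|constructor 2|constructor 3; right].
  + by constructor 3; left.
Qed.

Lemma well_ordered_ltn : well_ordered (fun m n : nat => m < n).
Proof.
split.
- by apply: (well_founded_lt_compat nat id) => m n /ltP.
- by move=> x y z; apply: ltn_trans.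
- by move=> x y; case: (ltngtP x y); [constructor 1|constructor 3|constructor 2].
Qed.

Lemma wf_recursion T (lt : T -> T -> Prop) (B : T -> Type)
    (F : forall x, (forall y, lt y x -> B y) -> B x) :
  well_founded lt ->
  exists f : forall x, B x, forall x, f x = F x (fun y _ => f y).
Proof.
move=> wf; exists (Fix wf B F) => x; apply: Fix_eq => {}x f g fg.
by congr F; do 2![apply: functional_extensionality_dep => ?].
Qed.

(** At [i], recursion picks an element of [S i] unlike all earlier values. The hypothesis covers
    arbitrary partial choices [g], so no invariant has to be carried. *)
Lemma greedy_injection I T (lt : I -> I -> Prop) (S : I -> set T) :
    well_ordered lt ->
    (forall i (g : forall j, lt j i -> T),
      exists x, S i x /\ forall j ji, g j ji <> x) ->
  exists G : I -> T, injective G /\ forall i, S i (G i).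
Proof.
move=> [wf _ tot] H.
have [G GE] := @wf_recursion I lt (fun=> T) (fun i g => sval (cid (H i g))) wf.
have GP i : S i (G i) /\ forall j, lt j i -> G j <> G i.
  by have := svalP (cid (H i (fun j _ => G j))); rewrite -GE.
exists G; split=> [i j e|i]; last by case: (GP i).
case: (tot i j) => // [ij|ji].
  by case: (GP j) => _ /(_ _ ij).
by case: (GP i) => _ /(_ _ ji); rewrite e.
Qed.

(** * Arithmetic of infinite cardinals *)

Lemma embeds_not_finite X Y :
  embeds nat X -> embeds X Y -> ~ finite_set [set: Y].
Proof. by move=> nX XY; apply/embeds_natP; apply: embeds_trans nX XY. Qed.

(* Pairs are well-ordered by their maximum first, so that every proper initial
   segment lies in the square of a segment [{y | y <= m}]. *)
Lemma embeds_square_segment T (lt : T -> T -> Prop) (D : T -> Prop) :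
    well_ordered lt ->
    (forall x y, D x -> lt y x -> D y) ->
    (forall x, D x -> embeds nat {y | lt y x} ->
      embeds ({y | lt y x} * {y | lt y x}) {y | lt y x}) ->
    embeds nat {y | D y} -> embeds ({y | D y} * {y | D y}) {y | D y}.
Proof.
move=> wo Dclosed IH nD; have [wf tr tot] := wo.
case: (pselect (exists x, D x /\ embeds {y | D y} {y | lt y x})).
  move=> [x [Dx Dseg]].
  apply: embeds_trans (embeds_prod Dseg Dseg) _.
  apply: embeds_trans (IH x Dx (embeds_trans nD Dseg)) _.
  by apply: embeds_sig => y; apply: Dclosed.
move=> initial.
pose sD := {y | D y}.
pose mx (p : sD * sD) := if `[< lt (sval p.1) (sval p.2) >] then p.2 else p.1.
pose ltD (x y : sD) := lt (sval x) (sval y).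
have woD : well_ordered ltD by apply: (well_ordered_preim (@sval_inj_prop _ _)).
pose ltp (p q : sD * sD) := lex ltD (lex ltD ltD) (mx p, p) (mx q, q).
have wop : well_ordered ltp.
  apply: (@well_ordered_preim _ _ (fun p => (mx p, p))).
    by move=> p q [].
  exact: (well_ordered_lex woD (well_ordered_lex woD woD)).
have [|G [GI _]] := @greedy_injection _ sD ltp (fun=> setT) wop; last by exists G.
move=> p g; apply: contrapT => none.
(* The choice is stuck at [p] only if the values at earlier pairs exhaust [sD]; then [sD] embeds
   into those pairs, hence into [L * L]. *)
have cover (x : sD) : exists q, ltp q p /\ forall h, g q h = x.
  apply: contrapT => nx; apply: none; exists x; split=> // q h e.
  by apply: nx; exists q; split=> // h'; rewrite (Prop_irrelevance h' h).
have [k kP] := choice cover.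
set m := sval (mx p).
pose L := {y | lt y m \/ y = m}.
have le_mx (q : sD * sD) (x : sD) : x = q.1 \/ x = q.2 ->
    lt (sval x) (sval (mx q)) \/ x = mx q.
  rewrite /mx; case: asboolP => lt12 [->|->]; [by left|by right|by right|].
  case: (tot (sval q.1) (sval q.2)) => [//|/sval_inj_prop -> |]; by [right|left].
have ltp_le (q : sD * sD) (x : sD) : ltp q p -> x = q.1 \/ x = q.2 ->
    lt (sval x) m \/ sval x = m.
  move=> qp /le_mx xq; case: qp => [/= qm|/= [e _]]; rewrite /m -?e.
    by left; case: xq => [xq|->] //; exact: tr xq qm.
  by case: xq => [|->]; [left|right].
have Dsq : embeds sD (L * L).
  exists (fun x => (exist _ _ (ltp_le _ _ (proj1 (kP x)) (or_introl erefl)),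
                    exist _ _ (ltp_le _ _ (proj1 (kP x)) (or_intror erefl))) : L * L).
  move=> x y [/sval_inj_prop e1 /sval_inj_prop e2].
  have e : k x = k y.
    by rewrite (surjective_pairing (k x)) (surjective_pairing (k y)) e1 e2.
  case: (kP x) (kP y) => h hx [_ hy].
  by rewrite -(hx h); move: h {hx}; rewrite e => h; apply: hy.
have Lseg : embeds L (option {y | lt y m}).
  exists (fun x : L => if pselect (lt (sval x) m) is left h
                       then Some (exist _ (sval x) h) else None).
  move=> x y; case: pselect => [h|nx]; case: pselect => [h'|ny] //.
    by move=> [/sval_inj_prop].
  by move=> _; apply: sval_inj_prop; case: (svalP x) (svalP y) => // -> [|->].
have Dm : D m by exact: svalP.
(* An infinite segment below [m] absorbs the extra point [m] and its own square, so [sD] would embed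
   into it, against [initial]; a finite one would make [sD] finite. *)
case: (pselect (embeds nat {y | lt y m})) => [nseg|fseg].
  have Lseg' := embeds_trans Lseg (embeds_option nseg).
  apply: initial; exists m; split=> //.
  apply: embeds_trans Dsq _; apply: embeds_trans (embeds_prod Lseg' Lseg') _.
  exact: IH.
have fin : finite_set [set: option {y | lt y m}].
  by apply: finite_option; apply: contrapT => /embeds_natP.
apply: (embeds_not_finite nD (embeds_trans Dsq (embeds_prod Lseg Lseg))).
exact: finite_prod.
Qed.

(** Hessenberg's theorem: induction settles the infinite proper segments, then [T] itself is treated
    as the segment with [D] constantly [True]. *)
Lemma embeds_square T : embeds nat T -> embeds (T * T) T.
Proof.
move=> nT; have [lt wo] := well_ordered_exists T.
have [wf tr _] := wo.
have seg x : embeds nat {y | lt y x} ->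
    embeds ({y | lt y x} * {y | lt y x}) {y | lt y x}.
  elim/(well_founded_ind wf): x => x IH.
  by apply: (embeds_square_segment wo) => // y z yx zy; apply: tr zy yx.
have TI : embeds T {y : T | True} by exists (exist _ ^~ I) => x y [].
apply: embeds_trans (embeds_prod TI TI) _.
apply: (@embeds_trans _ {y : T | True}); last by exists sval; apply: sval_inj_prop.
apply: (embeds_square_segment wo) => // [x _|]; first exact: seg.
exact: embeds_trans nT TI.
Qed.

(** Iterated pairing; the tags [n 0] and [n 1] separate the empty list from a cons. *)
Lemma embeds_seq T : embeds nat T -> embeds (seq T) T.
Proof.
move=> nT; have [n nI] := nT; have [p pI] := embeds_square nT.
pose code := foldr (fun x c => p (n 1, p (x, c))) (p (n 0, n 0)).
exists code; elim=> [|x s IH] [|y t] //=.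
- by move=> /pI [/nI].
- by move=> /pI [/nI].
- by move=> /pI [/pI [-> /IH ->]].
Qed.

(* If no row of [T * T] lands in [P], then every row meets [Q]. *)
Lemma embeds_or T U (P Q : U -> Prop) : embeds nat T ->
  embeds T {x | P x \/ Q x} -> embeds T {x | P x} \/ embeds T {x | Q x}.
Proof.
move=> nT TPQ; have [f fI] := embeds_trans (embeds_square nT) TPQ.
case: (pselect (exists a, forall b, P (sval (f (a, b))))) => [[a Pa]|nP].
  left; exists (fun b => exist P _ (Pa b)) => b c.
  by move=> [/sval_inj_prop /fI []].
right; have /choice [b bP] (a : T) : exists b, Q (sval (f (a, b))).
  apply: contrapT => nQ; apply: nP; exists a => b.
  by case: (svalP (f (a, b))) => // Qb; case: nQ; exists b.
by exists (fun a => exist Q _ (bP a)) => a c [/sval_inj_prop /fI []].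
Qed.

(** * Initial well-orders and greedy choice of children *)

(** If some segment embeds [T], take the least [x] with such a segment: [U] embeds below [x], and
    the order pulled back from there has only segments too small for [T]. *)
Lemma initial_well_order T U : embeds U T ->
  exists lt : U -> U -> Prop, well_ordered lt /\ forall x, ~ embeds T {y | lt y x}.
Proof.
move=> UT; have [lt wo] := well_ordered_exists U.
case: (pselect (exists x, embeds T {y | lt y x})) => [[x0 Tx0]|none]; last first.
  by exists lt; split=> // x Tx; apply: none; exists x.
have [wf _ _] := wo.
have [x [Tx xmin]] : exists x, embeds T {y | lt y x} /\
    forall z, lt z x -> ~ embeds T {y | lt y z}.
  elim/(well_founded_ind wf): x0 Tx0 => x IH Tx.
  case: (pselect (exists z, lt z x /\ embeds T {y | lt y z})) => [[z [/IH]]|] //.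
  by move=> none; exists x; split=> // z zx Tz; apply: none; exists z.
have [k kI] := embeds_trans UT Tx.
have skI : injective (fun u => sval (k u)) by move=> u v /sval_inj_prop /kI.
exists (fun u v => lt (sval (k u)) (sval (k v))); split.
  exact: (well_ordered_preim skI).
move=> z Tz; apply: (xmin (sval (k z)) (svalP (k z))); apply: embeds_trans Tz _.
exists (fun u : {u | lt (sval (k u)) (sval (k z))} =>
          exist (fun y => lt y (sval (k z))) (sval (k (sval u))) (svalP u)).
by move=> u v [/sval_inj_prop /kI /sval_inj_prop].
Qed.

(** Every vertex ends a walk from [x0], coded by the list over [A] of the neighbours chosen. *)
Lemma embeds_vertices A (G : graph) : embeds nat A -> connected_graph G ->
  (forall x : G, exists h : A -> G, forall y, adj x y -> exists a, h a = y) ->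
  embeds G A.
Proof.
move=> nA conn /choice[step stepP].
case: (pselect (exists x : G, True)) => [[x0 _]|noG]; last first.
  exists (fun x : G => False_rect A (noG (ex_intro _ x I))) => x.
  by case: noG; exists x.
have /choice[walk walkP] (x : G) : exists s : seq A, foldl step x0 s = x.
  elim: (conn x0 x) => {x} [x y /stepP[a xy]|x|x y z _ [s xs] _ [t yt]].
  - by exists [:: a].
  - by exists [::].
  - by exists (s ++ t); rewrite foldl_cat xs.
apply: embeds_trans _ (embeds_seq nA); exists walk => x y e.
by rewrite -(walkP x) e walkP.
Qed.

(** The greedy choice never gets stuck: [v] has [A] many neighbours not before it, whereas the pairs
    preceding a given one, ordered through [h], inject into a segment of [G], which cannot embed
    [A]. *)
Lemma greedy_children A W (G : graph) : embeds nat A -> embeds G A ->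
    (forall x : G, embeds A {y | adj x y}) -> embeds (G * W) G ->
  exists (lt : G -> G -> Prop) (g : G -> W -> G),
    [/\ well_ordered lt,
        forall v j v' j', g v j = g v' j' -> v = v' /\ j = j'
      & forall v j, adj v (g v j) /\ lt v (g v j)].
Proof.
move=> nA GA nbr [h hI]; have [lt [wo init]] := initial_well_order GA.
have [wf tr tot] := wo.
have up v : embeds A {y | adj v y /\ ~ lt y v}.
  suff /(embeds_or nA)[/init|] : embeds A {y | lt y v \/ (adj v y /\ ~ lt y v)} by [].
  apply: embeds_trans (nbr v) _; apply: embeds_sig => y vy.
  by case: (pselect (lt y v)); [left|right].
have wo' := well_ordered_preim hI wo.
have [|F [FI FS]] := @greedy_injection _ G _
    (fun p => [set y | adj p.1 y /\ ~ lt y p.1]) wo'.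
  move=> p g; apply: contrapT => none; apply: (init (h p)).
  apply: embeds_trans (up p.1) _.
  have /choice[k kP] (y : {y | adj p.1 y /\ ~ lt y p.1}) :
      exists q, exists qp : lt (h q) (h p), g q qp = sval y.
    apply: contrapT => ny; apply: none; exists (sval y); split; first exact: svalP.
    by move=> q qp e; apply: ny; exists q, qp.
  exists (fun y => exist (fun y => lt y (h p)) (h (k y))
                     (let: ex_intro qp _ := kP y in qp)).
  move=> y z [/hI e]; apply: sval_inj_prop.
  case: (kP y) (kP z) => qy <- [qz <-]; move: qy qz; rewrite e => qy qz.
  by rewrite (Prop_irrelevance qy qz).
exists lt, (fun v j => F (v, j)); split=> //.
  by move=> v j v' j' /FI [].
move=> v j; have [/= vF nlt] := FS (v, j); split=> //.
case: (tot v (F (v, j))) => // e.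
by case: (@adj_irrefl G v); rewrite {2}e.
Qed.

(** * Labelled forests: rigidity and construction *)

(** [f] preserves the labels of non-roots, hence the direction of edges; this forces roots to be
    fixed, and induction along [lt] then fixes every child, its siblings having other labels. *)
Lemma labelled_forest_rigid T W (lt : T -> T -> Prop) (ltW : W -> W -> Prop)
    (child : T -> T -> Prop) (lab : T -> W) :
    well_founded lt -> well_ordered ltW ->
    (forall v x, child v x -> lt v x) ->
    (forall v x, child v x -> ltW (lab x) (lab v)) ->
    (forall v w x, child v x -> child w x -> v = w) ->
    (forall v x y, child v x -> child v y -> lab x = lab y -> x = y) ->
    (forall v j, ltW j (lab v) -> exists x, child v x /\ lab x = j) ->
    (forall x y, (forall v, ~ child v x) -> (forall v, ~ child v y) ->
      lab x = lab y -> x = y) ->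
    (forall r j, (forall v, ~ child v r) -> ltW j (lab r) ->
      exists j', ltW j j' /\ ltW j' (lab r)) ->
  forall f : T -> T, bijective f ->
    (forall x y, child x y \/ child y x <->
      child (f x) (f y) \/ child (f y) (f x)) ->
  forall x, f x = x.
Proof.
move=> wf [wfW trW totW] child_lt child_lab parentE siblingE childE rootE rootlim.
move=> f fbij fred.
have [f' fK f'K] := fbij; have fI := can_inj fK.
have irr j : ~ ltW j j by apply: wf_irrefl.
have asym i j : ltW i j -> ~ ltW j i by apply: wf_asym.
pose red x y := child x y \/ child y x.
(* [N j x]: [x] is not a root and has label [j]; [B j x]: the same for a smaller
   label. [NQ] describes [N j] by [B j] and red adjacency alone, so [f]
   preserves [N j] by induction on [j]. Roots escape this description because
   their labels are not successors: they never have exactly one neighbour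
   outside [B j]. *)
pose N j x := (exists v, child v x) /\ lab x = j.
pose B j x := exists i, ltW i j /\ N i x.
have BE j x : B j x <-> (exists v, child v x) /\ ltW (lab x) j.
  split; first by move=> [i [ij [px xi]]]; rewrite xi.
  by move=> [px xj]; exists (lab x).
pose Q j x := ~ B j x /\ exists u, [/\ red x u, ~ B j u &
  forall w, red x w -> ~ B j w -> w = u].
have NQ j x : N j x <-> Q j x.
  split=> [[[v vx] xj]|[nBx [u [xu nBu uniq]]]].
    split; first by rewrite BE xj => -[_ /irr].
    exists v; split; first by right.
      by rewrite BE => -[_]; apply: asym; rewrite -xj; apply: child_lab.
    move=> w [xw|wx] nBw; last exact: parentE wx vx.
    by case: nBw; rewrite BE -xj; split; [exists x|exact: child_lab].
  case: (pselect (exists v, child v x)) => [[v vx]|root].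
    case: (totW (lab x) j) => [xj|xj|jx].
    - by case: nBx; rewrite BE; split=> //; exists v.
    - by split=> //; exists v.
    (* The child labelled [j] and the parent of [x] both lie outside [B j], so both equal [u], yet
       their labels lie on either side of [lab x]. *)
    - have [y [xy yj]] := childE _ _ jx.
      have eyu : y = u by apply: uniq; [left|rewrite BE yj => -[_ /irr]].
      have xv := child_lab _ _ vx.
      have evu : v = u.
        apply: uniq; first by right.
        by rewrite BE => -[_]; apply: asym; apply: trW jx xv.
      by move: jx; rewrite -yj eyu -evu => /(asym _ _ xv).
  have {}root v : ~ child v x by move=> vx; apply: root; exists v.
  case: xu => [xu|/root] //.
  have jx : ltW j (lab x).
    have ux := child_lab _ _ xu.
    case: (totW (lab u) j) => [uj|<- //|ju]; last exact: trW ju ux.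
    by case: nBu; rewrite BE; split=> //; exists x.
  have [j' [jj' j'x]] := rootlim _ _ root jx.
  have [y [xy yj]] := childE _ _ jx.
  have [y' [xy' yj']] := childE _ _ j'x.
  have e : y = u by apply: uniq; [left|rewrite BE yj => -[_ /irr]].
  have e' : y' = u by apply: uniq; [left|rewrite BE yj' => -[_ /(asym _ _ jj')]].
  by move: jj'; rewrite -yj -yj' e e' => /irr.
have redf x y : red x y <-> red (f x) (f y) by apply: fred.
have NF j : forall x, N j x <-> N j (f x).
  elim/(well_founded_ind wfW): j => j IH x.
  have Bf y : B j y <-> B j (f y).
    by split=> -[i [ij n]]; exists i; split=> //; apply/(IH i ij y).
  rewrite !NQ /Q -Bf; split=> -[nB [u [xu nBu uniq]]]; split=> //.
    exists (f u); split; [by rewrite -redf|by rewrite -Bf|].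
    by move=> w; rewrite -(f'K w) -redf -Bf => /uniq h /h ->.
  exists (f' u); split; [by rewrite redf f'K|by rewrite Bf f'K|].
  by move=> w; rewrite redf Bf => /uniq h /h <-; rewrite fK.
have labf v x : child v x -> lab (f x) = lab x /\ exists w, child w (f x).
  by move=> vx; have /NF[] : N (lab x) x by split=> //; exists v.
have pf v x : child v x -> child (f v) (f x).
  move=> vx; have [labx _] := labf _ _ vx.
  (* Were the edge reversed, [f v] would be a non-root, [v] would share its label, and the labels of
     [v] and [x] would each be below the other. *)
  have [//|xv] : red (f v) (f x) by rewrite -redf; left.
  have [[w wv] lv] : N (lab (f v)) v by rewrite NF; split=> //; exists (f x).
  have := child_lab _ _ xv; rewrite labx -lv => /asym; case.
  exact: child_lab.
have rootf x : (forall v, ~ child v x) -> forall v, ~ child v (f x).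
  move=> root v vfx.
  have [[w /root]] : N (lab (f x)) x by rewrite NF; split=> //; exists v.
  by [].
have fix_root x : (forall v, ~ child v x) -> f x = x.
  move=> root; apply: rootE => //; first exact: rootf.
  (* If the labels differed, the root with the larger one would have a child carrying the smaller;
     [f] or [f'] turns it into a child of the other root with that root's own label. *)
  case: (totW (lab (f x)) (lab x)) => // [fxx|xfx].
    have [y [xy yl]] := childE _ _ fxx.
    have [ly _] := labf _ _ xy.
    by have := child_lab _ _ (pf _ _ xy); rewrite ly yl => /irr.
  have [y [xy yl]] := childE _ _ xfx.
  have [[w wy] ly] : N (lab y) (f' y).
    by rewrite NF f'K; split=> //; exists (f x).
  have : red x (f' y) by rewrite redf f'K; left.
  case=> [xy'|/root //].
  by have := child_lab _ _ xy'; rewrite ly yl => /irr.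
elim/(well_founded_ind wf) => x IH.
case: (pselect (exists v, child v x)) => [[v vx]|root]; last first.
  by apply: fix_root => v vx; apply: root; exists v.
have [lx _] := labf _ _ vx.
apply: (siblingE v) => //.
by have := pf _ _ vx; rewrite (IH v) //; apply: child_lt.
Qed.

(** Recursion along [lt]: if [g v j = x], then [v] precedes [x], so [lab v] is known when [x] is
    labelled, and injectivity of [g] makes [j] unambiguous. [rho] labels the roots. *)
Lemma labelled_forest T W (lt : T -> T -> Prop) (ltW : W -> W -> Prop)
    (g : T -> W -> T) (rho : T -> W) :
    well_founded lt -> (forall v j, lt v (g v j)) ->
    (forall v j v' j', g v j = g v' j' -> v = v' /\ j = j') ->
  exists lab : T -> W,
    (forall v j, ltW j (lab v) -> lab (g v j) = j) /\
    (forall x, (forall v j, g v j = x -> ~ ltW j (lab v)) -> lab x = rho x).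
Proof.
move=> wf ltg gI.
have [lab labE] := @wf_recursion T lt (fun=> W) (fun x rec =>
  if pselect (exists p : T * W, exists vx : lt p.1 x,
                g p.1 p.2 = x /\ ltW p.2 (rec p.1 vx))
  is left e then (sval (cid e)).2 else rho x) wf.
exists lab; split=> [v j jv|x nx]; rewrite labE.
  case: pselect => [e|[]].
    by case: cid => -[v' j'] /= [_ [/gI[_ ->]]].
  by exists (v, j), (ltg v j).
by case: pselect => // -[[v j] [vx /= [e jv]]]; case: (nx v j e).
Qed.

(** * Colourings and the distinguishing index *)

Lemma distinguishing_comp (G : graph) C C' (h : C -> C') (c : edge G -> C) :
  injective h -> distinguishing c -> distinguishing (h \o c).
Proof. by move=> hI dc f fa fp; apply: dc => // e e' /fp /hI. Qed.

Lemma red_subgraph_distinguishing (G : graph) (child : G -> G -> Prop) :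
    (forall x y, child x y -> adj x y) ->
    (forall f : G -> G, bijective f ->
      (forall x y, child x y \/ child y x <->
        child (f x) (f y) \/ child (f y) (f x)) ->
      forall x, f x = x) ->
  exists c : edge G -> bool, distinguishing c.
Proof.
move=> child_adj rigid.
pose c (e : edge G) := `[< exists x y, child x y /\ sval e = [set x; y] >].
pose edg x y (xy : adj x y) : edge G :=
  exist _ [set x; y] (ex_intro _ x (ex_intro _ y (conj xy erefl))).
have cE x y (xy : adj x y) : c (edg x y xy) <-> child x y \/ child y x.
  split=> [/asboolP[u [v [uv /= e]]]|cxy]; last first.
    by apply/asboolP; case: cxy => ?; [exists x, y|exists y, x; rewrite setUC].
  have : [set x; y] u by rewrite e; left.
  have : [set x; y] v by rewrite e; right.
  have nuv : u <> v.
    move=> euv; apply: (@adj_irrefl G u).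
    by rewrite {2}euv; exact: child_adj.
  by move=> [/= ev|/= ev] [/= eu|/= eu]; move: uv nuv; rewrite ev eu; auto.
exists c => f [fbij fadj] fp; apply: rigid => // x y.
have red_adj u v : child u v \/ child v u -> adj u v.
  by move=> [/child_adj|/child_adj/adj_sym].
case: (pselect (adj x y)) => [xy|nxy].
  have fxy : adj (f x) (f y) by rewrite -fadj.
  rewrite -(cE _ _ xy) -(cE _ _ fxy) (fp (edg _ _ xy) (edg _ _ fxy)) //=.
  by rewrite image_setU !image_set1.
by split=> /red_adj => [//|/(fadj x y)].
Qed.

(** The least finite number [m] of colours works: a distinguishing palette [C] is infinite, or has
    some finite size [k], and then [m <= k] by minimality. *)
Lemma distinguishing_index_exists (G : graph) n (c : edge G -> 'I_n) :
  distinguishing c -> exists D, distinguishing_index G D /\ [set: D] #<= `I_n.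
Proof.
move=> dc; pose P m := `[< exists c : edge G -> 'I_m, distinguishing c >].
have exP : exists m, P m by exists n; apply/asboolP; exists c.
case: (ex_minnP exP) => m /asboolP Pm mmin.
have Ile k : [set: 'I_k] #<= `I_k.
  by have := @card_II k; rewrite card_eq_le => /andP[].
exists 'I_m; split; last first.
  apply: card_le_trans (Ile m) _; rewrite card_le_II; apply: mmin.
  by apply/asboolP; exists c.
split=> // C [c' dc']; rewrite -embeds_card_le.
case: (pselect (finite_set [set: C])) => [/finite_setP[k Ck]|/embeds_natP nC]; last first.
  by apply: embeds_trans nC; exists val; apply: val_inj.
have CI : [set: C] #= [set: 'I_k] by apply: card_eq_trans Ck _; exact: card_II.
have /andP[/embeds_card_le[h hI] /embeds_card_le IC] :
  ([set: C] #<= [set: 'I_k]) && ([set: 'I_k] #<= [set: C]) by rewrite -card_eq_le.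
apply: embeds_trans IC; have mk : m <= k.
  by apply: mmin; apply/asboolP; exists (h \o c'); apply: distinguishing_comp.
by exists (widen_ord mk) => x y /(congr1 val) /= /val_inj.
Qed.

(** * Assembly for regular graphs of infinite degree *)

Lemma bijective_sig T U (P : set T) :
  P #= [set: U] -> exists h : U -> {x | P x}, bijective h.
Proof.
move=> /card_esym /card_bijP[h [h' hK h'K]].
pose i (u : U) : [set: U] := SigSub (mem_set (I : [set: U] u)).
pose k (s : P) : {x | P x} := exist P (val s) (set_mem (valP s)).
pose k' (y : {x | P x}) : P := SigSub (mem_set (svalP y)).
exists (fun u => k (h (i u))); exists (fun y => val (h' (k' y))) => [u|y].
  by have -> : k' (k (h (i u))) = h (i u); [exact: val_inj|rewrite hK].
have -> : i (val (h' (k' y))) = h' (k' y) by exact: val_inj.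
by rewrite h'K; apply: sval_inj_prop.
Qed.

Theorem theorem2 (A : Type) (G : graph) (A_infinite : infinite_set [set: A])
    (G_connected : connected_graph G) (G_regular : regular A G) :
  exists D : Type, distinguishing_index G D /\ [set: D] #<= `I_2.
Proof.
have nA : embeds nat A by apply/embeds_natP.
suff [c dc] : exists c : edge G -> bool, distinguishing c.
  have [h hI] : embeds bool 'I_2.
    exists (fun b : bool => inord b) => -[] [] // /(congr1 val);
    by rewrite /= !inordK.
  exact: (distinguishing_index_exists (distinguishing_comp hI dc)).
(* The empty graph is separate, since [A] embeds into [G] through the neighbours of [x0]. *)
case: (pselect (exists x : G, True)) => [[x0 _]|noG]; last first.
  by exists (fun=> true) => f _ _ x; case: noG; exists x.
have nbr (x : G) : exists h : A -> {y | adj x y}, bijective h.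
  exact: bijective_sig (G_regular x).
have GA : embeds G A.
  apply: (embeds_vertices nA) => // x; have [h [h' _ h'K]] := nbr x.
  by exists (sval \o h) => y xy; exists (h' (exist _ y xy)); rewrite /= h'K.
have Anbr (x : G) : embeds A {y | adj x y}.
  by have [h /bij_inj] := nbr x; exists h.
have AG : embeds A G.
  by apply: embeds_trans (Anbr x0) _; exists sval; apply: sval_inj_prop.
(* Labels will be taken in [G * nat], which is small enough for the greedy choice. *)
have GWG : embeds (G * (G * nat)) G.
  apply: embeds_trans AG.
  apply: embeds_trans _ (embeds_square nA); apply: embeds_prod => //.
  by apply: embeds_trans _ (embeds_square nA); apply: embeds_prod.
have [lt [g [wo gI gadj]]] := greedy_children nA GA Anbr GWG.
have [wf _ _] := wo.
(* Labels [(x, 0)], given to the roots, are not successors here: if [(a, n)] is below [(x, 0)], then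
   [a] is before [x], and [(a, n.+1)] lies in between. *)
pose ltW := lex lt (fun m n : nat => m < n).
have woW : well_ordered ltW by exact: well_ordered_lex wo well_ordered_ltn.
have [lab [lab_child lab_root]] :=
  @labelled_forest G _ lt ltW g (fun x => (x, 0)) wf
    (fun v j => proj2 (gadj v j)) gI.
pose child v x := exists j, g v j = x /\ ltW j (lab v).
have root_lab x : (forall v, ~ child v x) -> lab x = (x, 0).
  by move=> root; apply: lab_root => v j vx jv; apply: (root v); exists j.
apply: (@red_subgraph_distinguishing G child).
  by move=> v _ [j [<- _]]; case: (gadj v j).
apply: (@labelled_forest_rigid G (G * nat) lt ltW child lab) => //.
- by move=> v _ [j [<- _]]; case: (gadj v j).
- by move=> v _ [j [<- jv]]; rewrite lab_child.
- by move=> v w _ [j [<- _]] [j' [/gI[]]].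
- by move=> v _ _ [j [<- jv]] [j' [<- j'v]]; rewrite !lab_child // => ->.
- by move=> v j jv; exists (g v j); rewrite lab_child //; split=> //; exists j.
- by move=> x y /root_lab-> /root_lab-> [].
- move=> r [a n] /root_lab-> [/= ar|[//]]; exists (a, n.+1).
  by split; [right|left].
Qed.
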